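(* Let $\mathbb{A}$ be a class of weakly saturated $\mathbf{FL_{ew}}$-chains such that for every $n\in\mathbb{N}$ there is some $\mathbf{A}_n\in\mathbb{A}$ that is not $n$-contractive. Let $\vdash$ be the global modal logic $\vdash_{K\mathbb{A}}$, let $\vdash^l$ be the local modal logic $\vdash^l_{K\mathbb{A}}$, and let $\vdash^l_{N_\Box}$ be the extension of $\vdash^l$ by the necessitation rule $x\vdash\Box x$. Then $\vdash$ does not coincide with $\vdash^l_{N_\Box}$.
   Context: An $\mathbf{FL_{ew}}$-algebra is a structure $\mathbf{A}=\langle A;\wedge,\vee,\cdot,\rightarrow,0,1\rangle$ where $\langle A;\wedge,\vee,0,1\rangle$ is a bounded lattice, $\langle A;\cdot,1\rangle$ is a commutative monoid, and $a\cdot b\le c$ iff $a\le b\rightarrow c$ for all $a,b,c$. Write $ab=a\cdot b$, $a^n$ for the $n$-fold product, $\neg a=a\rightarrow 0$. A chain is a linearly ordered $\mathbf{FL_{ew}}$-algebra. $\mathbf{A}$ is $n$-contractive if $a^{n+1}=a^n$ for all $a\in A$. $\mathbf{A}$ is weakly saturated if for all $a,b\in A$: if $a\le b^n$ for all $n\in\mathbb{N}$ then $ab=a$. Modal formulas (set $Fm$) are built from a countable set $\mathcal{V}$ of propositional variables using $\wedge,\vee,\cdot,\rightarrow,\neg,\overline{0},\overline{1}$ and unary $\Box,\Diamond$. An $\mathbf{A}$-Kripke model is $\mathfrak{M}=\langle W,R,e\rangle$ with $W\neq\emptyset$, $R\subseteq W\times W$ and $e:W\times\mathcal{V}\to A$,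 extended to formulas by interpreting propositional connectives and constants world-wise in $\mathbf{A}$ and $e(v,\Box\varphi)=\bigwedge_{Rvw}e(w,\varphi)$, $e(v,\Diamond\varphi)=\bigvee_{Rvw}e(w,\varphi)$. The model is safe if all these infima and suprema exist, for every formula and world. $K\mathbb{A}$ is the class of all safe $\mathbf{A}$-Kripke models with $\mathbf{A}\in\mathbb{A}$. Write $\mathfrak{M},v\models\varphi$ if $e(v,\varphi)=1$, and $\mathfrak{M}\models\varphi$ if $\mathfrak{M},v\models\varphi$ for all $v\in W$; similarly for sets. For finite $\Gamma\cup\{\varphi\}\subseteq Fm$: $\Gamma\vdash_{K\mathbb{A}}\varphi$ means that for every $\mathfrak{M}\in K\mathbb{A}$, $\mathfrak{M}\models\Gamma$ implies $\mathfrak{M}\models\varphi$; $\Gamma\vdash^l_{K\mathbb{A}}\varphi$ means that for every $\mathfrak{M}\in K\mathbb{A}$ and every world $v$, $\mathfrak{M},v\models\Gamma$ implies $\mathfrak{M},v\models\varphi$. For arbitrary $\Gamma$, each of the two relations holds iff it holds for some finite $\Gamma_0\subseteq\Gamma$. A logic is a set of pairs $\langle\Gamma,\varphi\rangle\in\mathcal{P}(Fm)\times Fm$ that is reflexive ($\langle\Gamma,\gamma\rangle$ for $\gamma\in\Gamma$), closed under cut (if $\langle\Gamma,\phi\rangle$ is in it for all $\phi\in\Phi$ and $\langle\Phi,\varphi\rangle$ is in it, then so is $\langle\Gamma,\varphi\rangle$) and closed under substitutions. $\vdash^l_{N_\Box}$ is the smallest logic containing all finitary derivations of $\vdash^l$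 and the rule $N_\Box:\ x\vdash\Box x$ ($x$ a variable). *)

(* Defs.v *)
From HB Require Import structures.
From mathcomp Require Import all_boot all_order.
From mathcomp Require Import boolp classical_sets functions cardinality.

Set Implicit Arguments.
Unset Strict Implicit.
Unset Printing Implicit Defensive.

Local Open Scope order_scope.
Local Open Scope classical_set_scope.

(** The constants 0 and 1 of an FL_ew-algebra are [\bot] and [\top]; [flew_one]
    identifies the latter with the monoid unit [1%g]. Lattice types carry a
    [choiceType] structure, which under the axiom of choice exists on every
    type. *)
HB.mixin Record isFLew (d : Order.disp_t) A
    of Order.TBLattice d A & Monoid A := {
  imp : A -> A -> A;
  flew_mulC : commutative (fun a b : A => (a * b)%g);
  flew_one : 1%g = \top :> A;
  flew_residuation : forall a b c : A, ((a * b)%g <= c) = (a <= imp b c)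
}.

#[short(type="flewType")]
HB.structure Definition FLew (d : Order.disp_t) :=
  { A of isFLew d A & Order.TBLattice d A & Monoid A }.

Section Algebras.
Variables (d : Order.disp_t) (A : flewType d).

Definition chain : Prop := total (<=%O : rel A).

Definition contractive (n : nat) : Prop :=
  forall a : A, (a ^+ n.+1)%g = (a ^+ n)%g.

Definition weakly_saturated : Prop :=
  forall a b : A, (forall n : nat, a <= (b ^+ n)%g) -> (a * b)%g = a.

End Algebras.

Arguments chain {d} A.
Arguments contractive {d} A n.
Arguments weakly_saturated {d} A.

Inductive form : Type :=
  | Var of nat
  | Bot
  | Top
  | And of form & form
  | Or of form & form
  | Mul of form & form
  | Imp of form & form
  | Neg of form
  | Box of form
  | Dia of form.

Fixpoint subst (s : nat -> form) (f : form) : form :=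
  match f with
  | Var x => s x
  | Bot => Bot
  | Top => Top
  | And g h => And (subst s g) (subst s h)
  | Or g h => Or (subst s g) (subst s h)
  | Mul g h => Mul (subst s g) (subst s h)
  | Imp g h => Imp (subst s g) (subst s h)
  | Neg g => Neg (subst s g)
  | Box g => Box (subst s g)
  | Dia g => Dia (subst s g)
  end.

Record model (d : Order.disp_t) (A : flewType d) := Model {
  world : Type;
  world_nonempty : inhabited world;
  access : world -> set world;
  valuation : world -> nat -> A
}.

Section Semantics.
Variables (d : Order.disp_t) (A : flewType d) (M : model A).

(** [infimum] and [supremum] return their first argument on the empty set, so
    that it has to be [\top] for [Box] and [\bot] for [Dia]. They also return it
    when the bound does not exist; [safe] excludes this. *)
Fixpoint eval (f : form) (v : world M) : A :=
  match f with
  | Var x => valuation v x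
  | Bot => \bot
  | Top => \top
  | And g h => (eval g v `&` eval h v)%O
  | Or g h => (eval g v `|` eval h v)%O
  | Mul g h => (eval g v * eval h v)%g
  | Imp g h => imp (eval g v) (eval h v)
  | Neg g => imp (eval g v) \bot
  | Box g => infimum \top (eval g @` access v)
  | Dia g => supremum \bot (eval g @` access v)
  end.

Definition safe : Prop :=
  forall (f : form) (v : world M),
    infimums (eval f @` access v) !=set0 /\
    supremums (eval f @` access v) !=set0.

Definition holds_at (v : world M) (G : set form) : Prop :=
  forall f, G f -> eval f v = \top.

Definition holds (G : set form) : Prop := forall v, holds_at v G.

End Semantics.

Section Logics.
Variables (d : Order.disp_t) (K : set (flewType d)).

Definition global_fin (G : set form) (f : form) : Prop :=
  forall A : flewType d, K A -> forall M : model A, safe M ->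
    holds M G -> holds M [set f].

Definition local_fin (G : set form) (f : form) : Prop :=
  forall A : flewType d, K A -> forall M : model A, safe M ->
    forall v : world M, holds_at v G -> holds_at v [set f].

Definition global_logic (G : set form) (f : form) : Prop :=
  exists G0 : set form, [/\ finite_set G0, G0 `<=` G & global_fin G0 f].

Definition local_logic (G : set form) (f : form) : Prop :=
  exists G0 : set form, [/\ finite_set G0, G0 `<=` G & local_fin G0 f].

End Logics.

Record is_logic (L : set form -> form -> Prop) : Prop := IsLogic {
  logic_refl : forall (G : set form) (g : form), G g -> L G g;
  logic_cut : forall (G P : set form) (f : form),
    (forall p, P p -> L G p) -> L P f -> L G f;
  logic_subst : forall (s : nat -> form) (G : set form) (f : form),
    L G f -> L (subst s @` G) (subst s f)
}.

(** The least logic is the intersection of all the logics with the required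
    derivations and rule. *)
Definition local_nec (d : Order.disp_t) (K : set (flewType d))
    (G : set form) (f : form) : Prop :=
  forall L : set form -> form -> Prop,
    is_logic L ->
    (forall (D : set form) (g : form),
       finite_set D -> local_logic K D g -> L D g) ->
    (forall x : nat, L [set Var x] (Box (Var x))) ->
    L G f.

(* Main.v *)
(** Take Gamma = { ~ Box 0, Dia p -> p, x -> p * Box x } and
    phi = (x -> x * p).  When Gamma holds globally, every world has a
    successor, p can only grow towards predecessors, and unfolding the third
    formula n times gives x <= p^n for all n; weak saturation then yields phi.

    A proof in the necessitation extension uses Gamma only up to some finite
    depth.  On the ray 0 -> 1 -> 2 -> ... evaluated in an algebra with
    a^(n+1) <> a^n, put p = a everywhere and x = a^(n-i) at world i.  Then
    Gamma holds at all worlds i < n while phi fails at 0.  Calling a formula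
    deeply valid when, for some N, it holds in the n-th model of this sequence
    at all worlds i with i + N <= n, preservation of deep validity (under all
    valuations, so as to be closed under substitution) is a logic containing
    the local derivations and necessitation, but not deriving phi. *)
Require Import Defs.
From mathcomp Require Import all_boot all_order.
From mathcomp Require Import boolp classical_sets cardinality.

Set Implicit Arguments.
Unset Strict Implicit.
Unset Printing Implicit Defensive.

Import Order.TTheory.
Local Open Scope order_scope.
Local Open Scope classical_set_scope.

Lemma infimum1 (d : Order.disp_t) (T : porderType d) (x0 x : T) :
  infimum x0 [set x] = x.
Proof.
rewrite /infimum ifF; last by apply/negbTE/set0P; exists x.
by rewrite infimums1; case: xgetP => // /(_ x)/(_ erefl).
Qed.

Section FLew.
Variables (d : Order.disp_t) (A : flewType d).
Implicit Types a b c : A.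

Lemma flew_le_mul a b c e : a <= b -> c <= e -> (a * c)%g <= (b * e)%g.
Proof.
have mono (x y z : A) : x <= y -> (x * z)%g <= (y * z)%g.
  by move=> le_xy; rewrite flew_residuation (le_trans le_xy)// -flew_residuation.
move=> le_ab le_ce; apply: le_trans (mono _ _ c le_ab) _.
by rewrite !(flew_mulC b); apply: mono.
Qed.

Lemma flew_mul_ler a b : (a * b)%g <= a.
Proof. by rewrite -[leRHS]mulg1 flew_le_mul// flew_one lex1. Qed.

Lemma flew_imp_top a b : (imp a b = \top) <-> (a <= b).
Proof.
rewrite -[a in a <= b]mul1g flew_one flew_residuation.
by split=> [->//|le1]; apply/le_anti; rewrite lex1.
Qed.

End FLew.

Section Evaluation.
Variables (d : Order.disp_t) (A : flewType d) (M : model A).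
Hypothesis safeM : safe M.

Lemma eval_Box_le f (v w : world M) : access v w -> eval (Box f) v <= eval f w :> A.
Proof.
move=> vw /=; have [inf0 _] := safeM f v.
rewrite /infimum ifF; last by apply/negbTE/set0P; exists (eval f w), w.
by have [lb _] := xgetPex \top inf0; apply: lb; exists w.
Qed.

Lemma eval_Dia_ge f (v w : world M) : access v w -> eval f w <= eval (Dia f) v :> A.
Proof.
move=> vw /=; have [_ sup0] := safeM f v.
rewrite /supremum ifF; last by apply/negbTE/set0P; exists (eval f w), w.
by have [ub _] := xgetPex \bot sup0; apply: ub; exists w.
Qed.

End Evaluation.

Definition nec_premises : set form :=
  [set Neg (Box Bot); Imp (Dia (Var 1)) (Var 1);
       Imp (Var 0) (Mul (Var 1) (Box (Var 0)))].

Definition nec_conclusion : form := Imp (Var 0) (Mul (Var 0) (Var 1)).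

Lemma finite_nec_premises : finite_set nec_premises.
Proof. by rewrite !finite_setU; do !split; exact: finite_set1. Qed.

(** Induction on n for all worlds at once, as the step moves from v to a successor w: at v, x <= p *
    Box x, where Box x is at most x at w, hence at most p^n at w. *)
Lemma le_expg_of_premises (d : Order.disp_t) (A : flewType d) (M : model A) :
  safe M -> holds M nec_premises ->
  forall n (v : world M), eval (Var 0) v <= (eval (Var 1) v ^+ n)%g :> A.
Proof.
move=> safeM MG; elim=> [v|n IHn v]; first by rewrite expg0 flew_one lex1.
have serial : eval (Neg (Box Bot)) v = \top by apply: MG; left; left.
have /flew_imp_top pP : eval (Imp (Dia (Var 1)) (Var 1)) v = \top.
  by apply: MG; left; right.
have /flew_imp_top xP :
    eval (Imp (Var 0) (Mul (Var 1) (Box (Var 0)))) v = \top.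
  by apply: MG; right.
have [/eqP acc0|/set0P[w vw]] := boolP (access v == set0).
  (* A world without successors is only possible in the trivial algebra. *)
  move: serial => /flew_imp_top /=; rewrite acc0 image_set0.
  rewrite /infimum eqxx => top_le_bot.
  exact: le_trans (lex1 _) (le_trans top_le_bot (le0x _)).
apply: le_trans xP _; rewrite expgS flew_le_mul//.
apply: le_trans (eval_Box_le safeM (Var 0) vw) (le_trans (IHn w) _).
have le_p : eval (Var 1) w <= eval (Var 1) v :> A.
  exact: le_trans (eval_Dia_ge safeM (Var 1) vw) pP.
by elim: n {IHn} => [|n IHn]; rewrite ?expg0// !expgS flew_le_mul.
Qed.

Lemma global_nec_conclusion (d : Order.disp_t) (K : set (flewType d)) :
  (forall A, K A -> weakly_saturated A) ->
  global_logic K nec_premises nec_conclusion.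
Proof.
move=> Ksat; exists nec_premises; split=> //; first exact: finite_nec_premises.
move=> A KA M safeM MG v _ ->; apply/flew_imp_top => /=.
by rewrite (Ksat A KA)// => n; apply: le_expg_of_premises.
Qed.

Section Ray.
Variables (d : Order.disp_t) (A : flewType d) (e : nat -> nat -> A).

Definition ray : model A :=
  @Model d A nat (inhabits 0%N) (fun i => [set i.+1]) e.

(** Each world has exactly one successor, so only bounds of singletons occur and [A] may be
    incomplete. *)
Lemma safe_ray : safe ray.
Proof.
move=> f v /=; rewrite image_set1 infimums1 supremums1.
by split; exists (@eval d A ray f v.+1).
Qed.

Lemma eval_Box_ray f i : @eval d A ray (Box f) i = @eval d A ray f i.+1.
Proof. by rewrite /= image_set1 infimum1. Qed.

Lemma eval_Dia_ray f i : @eval d A ray (Dia f) i = @eval d A ray f i.+1.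
Proof. by rewrite /= image_set1 supremum1. Qed.

End Ray.

(** Substituting amounts to revaluing the variables on the same ray. *)
Lemma eval_subst_ray (d : Order.disp_t) (A : flewType d) (e : nat -> nat -> A)
    (s : nat -> form) (f : form) (i : nat) :
  @eval d A (ray e) (subst s f) i =
  @eval d A (ray (fun j x => @eval d A (ray e) (s x) j)) f i.
Proof.
elim: f i => //= [g IHg h IHh i|g IHg h IHh i|g IHg h IHh i|g IHg h IHh i
  |g IHg i|g IHg i|g IHg i]; rewrite ?IHg ?IHh//.
all: by rewrite !image_set1 IHg.
Qed.

Section DeepValidity.
Variables (d : Order.disp_t) (A : nat -> flewType d).
Implicit Type e : forall n, nat -> nat -> A n.

Definition deeply_valid e (f : form) : Prop :=
  exists N, forall n i, (i + N <= n)%N -> @eval d _ (ray (e n)) f i = \top.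

Definition deep_logic (G : set form) (f : form) : Prop :=
  forall e, (forall g, G g -> deeply_valid e g) -> deeply_valid e f.

Lemma is_logic_deep : is_logic deep_logic.
Proof.
split=> [G g Gg e|G P f GP Pf e eG|s G f Gf e eG]; first exact.
  by apply: Pf => p Pp; apply: GP.
have [|N Nf] := Gf (fun n j x => @eval d _ (ray (e n)) (s x) j).
  move=> g Gg; have [|N Ng] := eG (subst s g); first by exists g.
  by exists N => n i /Ng; rewrite eval_subst_ray.
by exists N => n i /Nf; rewrite eval_subst_ray.
Qed.

(** Finitely many depths have a maximum, which serves all of [D]. *)
Lemma deeply_valid_finite e (D : set form) : finite_set D ->
  (forall g, D g -> deeply_valid e g) ->
  exists N, forall n i, (i + N <= n)%N -> holds_at (i : world (ray (e n))) D.
Proof.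
move=> finD eD.
have /choice[N NP] : forall g, exists N, D g -> forall n i, (i + N <= n)%N ->
    @eval d _ (ray (e n)) g i = \top.
  by move=> g; have [/eD[N ?]|?] := pselect (D g); [exists N|exists 0%N].
have /finite_seqP[s sE] := finite_image N finD.
exists (\max_(k <- s) k) => n i le_n g Dg; apply: NP => //.
apply: leq_trans le_n; rewrite leq_add2l.
apply: (@leq_bigmax_seq _ _ xpredT id) => //.
by have : (N @` D) (N g) by [exists g]; rewrite sE.
Qed.

Lemma deep_local (K : set (flewType d)) (D : set form) (f : form) :
  (forall n, K (A n)) -> local_logic K D f -> deep_logic D f.
Proof.
move=> KA [G [finG GD Gf]] e eD.
have [|N NG] := deeply_valid_finite (e := e) finG; first by move=> g /GD/eD.
exists N => n i /NG Gi.
exact: (Gf _ (KA n) _ (safe_ray (e := e n)) i Gi f erefl).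
Qed.

Lemma deep_nec (f : form) : deep_logic [set f] (Box f).
Proof.
(* Box looks one world ahead, which costs one unit of depth. *)
move=> e /(_ f erefl)[N Nf]; exists N.+1 => n i le_n.
by rewrite eval_Box_ray Nf// addSnnS.
Qed.

Lemma deep_nec_conclusion :
  deep_logic nec_premises nec_conclusion -> exists n, contractive (A n) n.
Proof.
move=> Gf; apply: contrapT => /forallNP ncontr.
have a_ n : {a : A n | (a ^+ n.+1)%g <> (a ^+ n)%g}.
  exact/cid/existsNP/ncontr.
pose a n := sval (a_ n).
(* Variable 0 is x and variable 1 is p. Truncated subtraction makes x equal to 1 from world n on,
   where the third premise may fail. *)
pose e n (i x : nat) := if x == 0%N then (a n ^+ (n - i))%g else a n.
have [g Gg|N /(_ N 0%N (leqnn _))] := Gf e; last first.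
  (* At world 0 of the [N]-th model, phi says a^N <= a^(N+1), against the choice of a. *)
  move=> /flew_imp_top; rewrite /= /e /= subn0 -expgSr => le_a.
  by apply: (svalP (a_ N)); apply/le_anti; rewrite le_a expgSr flew_mul_ler.
(* Depth 1 gives i < n, so that a^(n-i) = a * a^(n-(i+1)). *)
exists 1%N => n i; rewrite addn1 => lt_in.
case: Gg => [[->|->]|->]; apply/flew_imp_top.
- by rewrite [leLHS](eval_Box_ray Bot).
- by rewrite [leLHS](eval_Dia_ray (Var 1)).
- rewrite [infimum _ _](eval_Box_ray (Var 0)) /= /e /=.
  by rewrite -expgS subnSK.
Qed.

End DeepValidity.

Theorem theorem5p2 (d : Order.disp_t) (K : set (flewType d))
    (Kchain : forall A : flewType d, K A -> chain A)
    (Ksat : forall A : flewType d, K A -> weakly_saturated A)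
    (Kncontr : forall n : nat,
       exists A : flewType d, K A /\ ~ contractive A n) :
  ~ (forall (G : set form) (f : form),
       global_logic K G f <-> local_nec K G f).
Proof.
move=> coincide.
have /coincide gamma_phi := global_nec_conclusion Ksat.
have [A /all_and2[KA ncontr]] := choice Kncontr.
have [|n /ncontr//] := @deep_nec_conclusion d A.
(* [deep_logic A] is one of the logics that [local_nec] intersects. *)
apply: gamma_phi (is_logic_deep A) _ _ => [D g _|x]; last exact: deep_nec.
exact: deep_local.
Qed.
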